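(* Let $p$ be an odd prime and $n\ge 1$. The upper and the lower central series of $W_n$ coincide; that is, if $c$ denotes the nilpotency class of $W_n$, then $Z_i(W_n)=\gamma_{c+1-i}(W_n)$ for all $0\le i\le c$.
   Context: Let $p$ be an odd prime and $n\ge 1$ an integer. For $1\le k\le n$ let $B_k=\mathrm{Fun}(\mathbb{F}_p^{k-1},\mathbb{F}_p)$ (additive group; $B_1=\mathbb{F}_p$). Write $f\Delta_k$ for $f$ regarded as an element of $B_k$. The element $f\Delta_k$ acts on $\mathbb{F}_p^n$ as the permutation $x=(x_1,\dots,x_n)\mapsto x-f(x_1,\dots,x_{k-1})e_k$, where $e_k$ is the $k$-th canonical basis vector. $W_n$ is the subgroup of $\mathrm{Sym}(\mathbb{F}_p^n)\cong \mathrm{Sym}(p^n)$ generated by $B_1,\dots,B_n$; it is the $n$-fold iterated wreath product of $\mathbb{F}_p$ and a Sylow $p$-subgroup of $\mathrm{Sym}(p^n)$. Here $\gamma_1(W_n)=W_n$, $\gamma_{i+1}(W_n)=[\gamma_i(W_n),W_n]$ is the lower central series and $Z_0(W_n)=1$, $Z_{i+1}(W_n)/Z_i(W_n)=Z(W_n/Z_i(W_n))$ is the upper central series. *)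

(* Defs.v *)
From HB Require Import structures.
From mathcomp Require Import all_boot all_order all_algebra all_fingroup all_solvable.

Set Implicit Arguments.
Unset Strict Implicit.
Unset Printing Implicit Defensive.

Import GRing.Theory.
Local Open Scope ring_scope.

(* Coordinates are numbered from 0, so k : 'I_n stands for the index k + 1 of  *)
(* the usual numbering from 1, and the coordinates strictly before it form a   *)
(* vector of length k.                                                         *)
Definition prefix p n (k : 'I_n) (x : 'rV['F_p]_n) : 'rV['F_p]_k :=
  \row_(i < k) x 0 (widen_ord (ltnW (ltn_ord k)) i).

Definition Delta_fun p n (k : 'I_n) (f : {ffun 'rV['F_p]_k -> 'F_p})
    (x : 'rV['F_p]_n) : 'rV['F_p]_n :=
  x - f (prefix k x) *: delta_mx 0 k.

Lemma prefix_Delta_fun p n (k : 'I_n) (f : {ffun 'rV['F_p]_k -> 'F_p}) x :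
  prefix k (Delta_fun f x) = prefix k x.
Proof.
apply/rowP=> i; rewrite !mxE -[_ == k]val_eqE /= (ltn_eqF (ltn_ord i)).
by rewrite mulr0 subr0.
Qed.

Lemma Delta_fun_inj p n (k : 'I_n) (f : {ffun 'rV['F_p]_k -> 'F_p}) :
  injective (Delta_fun f).
Proof.
move=> x y eq_xy; have := eq_xy; rewrite /Delta_fun.
rewrite -(prefix_Delta_fun f x) eq_xy prefix_Delta_fun.
exact: addIr.
Qed.

Definition Delta p n (k : 'I_n) (f : {ffun 'rV['F_p]_k -> 'F_p}) :
  {perm 'rV['F_p]_n} := perm (@Delta_fun_inj p n k f).

Definition B p n (k : 'I_n) : {set {perm 'rV['F_p]_n}} :=
  [set Delta f | f : {ffun 'rV['F_p]_k -> 'F_p}].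

Definition W p n : {group {perm 'rV['F_p]_n}} :=
  <<\bigcup_(k < n) B p k>>%G.

(* Main.v *)
From HB Require Import structures.
Require Import Defs.
From mathcomp Require Import all_boot all_order all_algebra all_fingroup all_solvable.

Set Implicit Arguments.
Unset Strict Implicit.
Unset Printing Implicit Defensive.

Import GRing.Theory.

(** Number coordinates from 0 and let the permutations of X = F_p^n act on the
    functions X -> F_p by composition.  The group W_n contains the odometer sigma,
    which adds one with carry to a word of n digits in base p, the coordinate 0
    being the least significant; so sigma^(p^m) fixes the first m coordinates and
    adds 1 to the next one.  Put U f = f o sigma - f and V w = ker U^w.  In
    characteristic p, U^(p^m) f = f o sigma^(p^m) - f, and therefore V (p^m) is the
    space of the functions of the first m coordinates (V_depends).  On it U is
    a single nilpotent Jordan block of size p^m, so that V w has dimension w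
    and U maps V (w + 1) onto V w as long as w < p^m (V_diff_onto, for m < n).

    An element g of W_n is given by its displacements x_k |-> x_k + d_k(x),
    where d_k depends on the coordinates before k, that is, d_k is in V (p^k).
    Let D i be the set of the g with d_k in V (p^k - i) for all k.  The theorem
    follows from the two equalities
      L_(i+1)(W_n) = D i (lcn_W)   and   Z_i(W_n) = D (c - i) (ucn_W),
    where c is the nilpotency class of W_n.

    - Every g in W_n maps V w to itself and f o g - f lies in V (w - 1) if f is
      in V w; more precisely, if g fixes the first l coordinates, then it
      lowers V (p^l w) to V (p^l (w - 1)) (diff_lowers).  Indeed sigma^(p^m)
      commutes with g on functions of the first m + 1 coordinates, so some
      power of U^(p^m) reduces the claim to functions of fewer coordinates.
      Inserted in the formula for the displacement of a commutator
      (pull_disp_commg), this gives [D i, W_n] <= D (i + 1) (commg_D).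
    - As U maps V (w + 1) onto V w, commutators with sigma^-1 of elements of D i
      realise all leading displacements of elements of D (i + 1), whence
      D (i + 1) = [D i, W_n].
    - Conversely let i < p^(n-1) and let g commute with W_n modulo D (i + 1).
      The commutator with sigma gives U d_k in V (p^k - i - 1), hence d_k is in
      V (p^k - i) when i < p^k.  When p^k <= i, it only says that d_k is
      constant.  If this constant were not 0, then some power of g would act
      like sigma^(p^k) on the functions of the first k + 1 coordinates; this
      lowers V (w + p^k) no further than to V w, which is incompatible with
      the commutators of g with the displacements of the coordinate k + 1.
      So g is in D i (central_mod_D). *)

(** * Composition operators on functions *)

Section CentralSeries.

Local Open Scope ring_scope.

Variables p n : nat.
Hypothesis p_prime : prime p.

Local Notation X := 'rV['F_p]_n.
Local Notation fn := {ffun X -> 'F_p}.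

Implicit Types (g h : {perm X}) (f : fn) (x y : X) (j k : 'I_n).

Definition pull g f : fn := [ffun x => f (g x)].
Definition diff g f : fn := pull g f - f.

Lemma pull_is_additive g : zmod_morphism (pull g).
Proof. by move=> f f'; apply/ffunP=> x; rewrite !ffunE. Qed.

HB.instance Definition _ g :=
  GRing.isZmodMorphism.Build fn fn (pull g) (pull_is_additive g).

Lemma diff_is_additive g : zmod_morphism (diff g).
Proof. by move=> f f'; rewrite /diff raddfB /= !opprD addrACA. Qed.

HB.instance Definition _ g :=
  GRing.isZmodMorphism.Build fn fn (diff g) (diff_is_additive g).

Lemma diffE g f x : diff g f x = f (g x) - f x.
Proof. by rewrite !ffunE. Qed.

Lemma pull1 f : pull 1%g f = f.
Proof. by apply/ffunP=> x; rewrite ffunE perm1. Qed.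

Lemma pullM g h f : pull (g * h)%g f = pull g (pull h f).
Proof. by apply/ffunP=> x; rewrite !ffunE permM. Qed.

Lemma pullX g t f : pull (g ^+ t)%g f = iter t (pull g) f.
Proof. by elim: t => [|t IHt]; rewrite ?pull1 // expgS pullM IHt. Qed.

Lemma pull_inj g : injective (pull g).
Proof. by apply: (can_inj (g := pull g^-1%g)) => f; rewrite -pullM mulVg pull1. Qed.

Lemma pull_diff g f : pull g f = f + diff g f.
Proof. by rewrite /diff addrC subrK. Qed.

Lemma iter_diff0 g t : iter t (diff g) 0 = 0.
Proof. by elim: t => //= t ->; rewrite raddf0. Qed.

Lemma iter_diffD g t f f' :
  iter t (diff g) (f + f') = iter t (diff g) f + iter t (diff g) f'.
Proof. by elim: t => //= t ->; rewrite raddfD. Qed.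

Lemma iter_diffN g t f : iter t (diff g) (- f) = - iter t (diff g) f.
Proof. by elim: t => //= t ->; rewrite raddfN. Qed.

(** Composition with g is 1 + diff g; this is the binomial formula for its powers. *)
Lemma iter_pull_binomial g f t :
  iter t (pull g) f = \sum_(i < t.+1) iter i (diff g) f *+ 'C(t, i).
Proof.
elim: t => [|t IHt]; first by rewrite big_ord1.
rewrite iterS IHt pull_diff [in RHS]big_ord_recl /= [in X in X + _]big_ord_recl /=.
rewrite !bin0 -addrA; congr (_ + _).
under [in RHS]eq_bigr => i _ do rewrite /bump /= add1n binS mulrnDr.
rewrite big_split /=; congr (_ + _).
  rewrite [in RHS]big_ord_recr /= bin_small // mulr0n addr0.
  by apply: eq_bigr => i _.
by rewrite raddf_sum; apply: eq_bigr => i _; rewrite raddfMn.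
Qed.

Lemma natp0 : p%:R = 0 :> 'F_p.
Proof. exact: (pcharf0 (pchar_Fp p_prime)). Qed.

Lemma mulrp_fn f : f *+ p = 0.
Proof.
by apply/ffunP=> x; rewrite ffunMnE !ffunE -mulr_natr natp0 mulr0.
Qed.

Lemma diff_Frobenius1 g f : diff (g ^+ p)%g f = iter p (diff g) f.
Proof.
suff: forall t, t = p -> diff (g ^+ t)%g f = iter t (diff g) f by apply.
case=> [|q] Eq; first by have := prime_gt0 p_prime; rewrite -[X in (_ < X)%N]Eq.
rewrite {1}/diff pullX iter_pull_binomial big_ord_recl big_ord_recr /=.
rewrite /bump /= add1n big1 => [|i _].
  by rewrite bin0 binn !mulr1n add0r addrC addKr.
have /dvdnP[c ->]: (p %| 'C(q.+1, (1 + i)))%N.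
  by rewrite Eq; apply: prime_dvd_bin; rewrite // -Eq add1n /= ltnS ltn_ord.
by rewrite mulnC mulrnA mulrp_fn mul0rn.
Qed.

(** The Frobenius rule (a - 1)^(p^m) = a^(p^m) - 1 for the operator a = pull g. *)
Lemma diff_Frobenius g m f :
  diff (g ^+ (p ^ m))%g f = iter (p ^ m) (diff g) f.
Proof.
elim: m f => [|m IHm] f; first by rewrite expn0 expg1.
rewrite expnSr expgM diff_Frobenius1 mulnC iterM.
by apply: eq_iter => f'; rewrite IHm.
Qed.

(** * Triangular permutations *)

Definition agree m x y := forall k, (k < m)%N -> x 0 k = y 0 k.
Definition depends m f := forall x y, agree m x y -> f x = f y.
Definition disp g k : fn := [ffun x => g x 0 k - x 0 k].
(** This describes all of W_n, see W_eq_D0. *)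
Definition triangular g := forall k, depends k (disp g k).

Lemma dispP g k x : g x 0 k = x 0 k + disp g k x.
Proof. by rewrite ffunE addrC subrK. Qed.

Lemma agree_sub m m' x y : (m <= m')%N -> agree m' x y -> agree m x y.
Proof. by move=> le_m Axy k lt_k; apply: Axy; apply: leq_trans le_m. Qed.

Lemma agree_all x y : agree n x y -> x = y.
Proof. by move=> Axy; apply/rowP=> k; apply: Axy. Qed.

Lemma triangular_agree g m x y : triangular g -> agree m x y -> agree m (g x) (g y).
Proof.
move=> Tg Axy k lt_k; rewrite !dispP Axy // (Tg k x y) //.
by apply: agree_sub Axy; apply: ltnW.
Qed.

Lemma depends_pull g m f : triangular g -> depends m f -> depends m (pull g f).
Proof. by move=> Tg Df x y Axy; rewrite !ffunE; apply/Df/triangular_agree. Qed.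

Lemma depends_sub m m' f : (m <= m')%N -> depends m f -> depends m' f.
Proof. by move=> le_m Df x y Axy; apply/Df/(agree_sub le_m). Qed.

Lemma dependsB m f f' : depends m f -> depends m f' -> depends m (f - f').
Proof. by move=> Df Df' x y Axy; rewrite !ffunE (Df x y) // (Df' x y). Qed.

Lemma depends_diff g m f : triangular g -> depends m f -> depends m (diff g f).
Proof. by move=> Tg Df; apply: dependsB (depends_pull Tg Df) Df. Qed.

Lemma diff_fixed g m f : (forall x, agree m (g x) x) -> depends m f -> diff g f = 0.
Proof. by move=> Fg Df; apply/ffunP=> x; rewrite !ffunE (Df _ x) // subrr. Qed.

(** * The odometer *)

(** The coordinate m of the odometer advances when the coordinates before it
    are all 0, rather than p - 1: a change of origin that saves a sign. *)
Definition carry (m : nat) : fn :=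
  [ffun x : X => [forall i : 'I_n, (i < m)%N ==> (x 0 i == 0)]%:R].

Lemma carry0 x : carry 0 x = 1.
Proof.
rewrite ffunE; suff ->: [forall i : 'I_n, (i < 0)%N ==> (x 0 i == 0)] by [].
exact/forallP.
Qed.

Lemma carryS k x : carry k.+1 x = carry k x * (x 0 k == 0)%:R.
Proof.
rewrite !ffunE -natrM mulnb; congr (_ %:R); congr (nat_of_bool _).
apply/forallP/andP=> [x0|[/forallP x0 xk0] i].
  split; last by have:= x0 k; rewrite ltnSn.
  by apply/forallP=> i; apply/implyP=> lt_i; have:= x0 i; rewrite ltnS ltnW.
apply/implyP; rewrite ltnS leq_eqVlt => /predU1P[/val_inj->//|lt_i].
by have:= x0 i; rewrite lt_i.
Qed.

Lemma depends_carry m : depends m (carry m).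
Proof.
move=> x y Axy; rewrite !ffunE; congr (_ %:R); congr (nat_of_bool _).
by apply: eq_forallb => i; apply: implyb_id2l => lt_i; rewrite Axy.
Qed.

Definition odo_fun x : X := \row_k (x 0 k + carry k x).

Lemma odo_inj : injective odo_fun.
Proof.
move=> x y eq_xy; apply: agree_all.
elim: n {-2}n (leqnn n) => [|N IHN] m le_m k lt_k; first by case: m le_m lt_k.
have:= congr1 (fun z : X => z 0 k) eq_xy; rewrite !mxE.
rewrite (depends_carry (y := y)); first exact: addIr.
by apply: IHN; rewrite -ltnS (leq_trans lt_k).
Qed.

Definition odo : {perm X} := perm odo_inj.

Lemma disp_odo k : disp odo k = carry k.
Proof. by apply/ffunP=> x; rewrite ffunE permE mxE addrC addKr. Qed.

Lemma triangular_odo : triangular odo.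
Proof. by move=> k; rewrite disp_odo; apply: depends_carry. Qed.

Lemma odoX k t x :
  (odo ^+ t)%g x 0 k = x 0 k + \sum_(0 <= s < t) carry k ((odo ^+ s)%g x).
Proof.
elim: t => [|t IHt]; first by rewrite big_geq // perm1 addr0.
by rewrite big_nat_recr //= expgSr permM dispP disp_odo IHt -addrA.
Qed.

(** As b runs through F_p, so does a + b. *)
Lemma sum_digit0 (a : 'F_p) : \sum_(0 <= b < p) ((a + b%:R == 0)%:R : 'F_p) = 1.
Proof.
rewrite big_mkord.
have lt_b : ((- a : 'F_p) < p)%N by rewrite -[X in (_ < X)%N](Fp_cast p_prime).
rewrite (bigD1 (Ordinal lt_b)) // [X in a + X](natr_Zp (- a)).
rewrite subrr eqxx big1 => [|b neq_b]; first exact: addr0.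
case: eqP => // ab0; case/eqP: neq_b; apply: ord_inj.
have Eb: b%:R = - a by rewrite -[LHS](addKr a) ab0 addr0.
by rewrite -[RHS]/(nat_of_ord (- a)) -Eb val_Fp_nat // modn_small.
Qed.

(** The second part says that the coordinate m advances exactly once in p^m
    steps.  Both parts have to be proved together: write a time t < p^(m+1) as
    a + b p^m; going from a to t leaves the first m coordinates unchanged and
    adds b to the coordinate m, so that for each a exactly one b contributes. *)
Lemma odo_cycle m x : (m <= n)%N ->
  agree m ((odo ^+ (p ^ m))%g x) x
    /\ \sum_(0 <= t < p ^ m) carry m ((odo ^+ t)%g x) = 1.
Proof.
elim: m x => [|m IHm] x lt_m.
  by split=> //; rewrite expn0 big_nat1 carry0.
have {}IHm y := IHm y (ltnW lt_m).
pose k := Ordinal lt_m; pose s := (odo ^+ (p ^ m))%g.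
have sX b y : agree m ((s ^+ b)%g y) y /\ (s ^+ b)%g y 0 k = y 0 k + b%:R.
  elim: b => [|b [IHb IHk]]; first by rewrite perm1 addr0.
  rewrite expgSr permM; have [IHs IHc] := IHm ((s ^+ b)%g y).
  split=> [i lt_i|]; first by rewrite IHs // IHb.
  by rewrite odoX IHc IHk -addrA natr1.
split=> [i|].
  rewrite ltnS leq_eqVlt expnSr expgM => /predU1P[/(@val_inj _ _ _ i k)->|].
    by rewrite (sX p x).2 natp0 addr0.
  exact: (sX p x).1.
rewrite expnSr mulnC big_nat_mul.
under eq_bigr => b _ do rewrite -{1}[(b * _)%N]add0n big_addn mulSn addnK.
rewrite exchange_big /= -[RHS](IHm x).2; apply: eq_bigr => a _.
set y := (odo ^+ a)%g x.
transitivity (\sum_(0 <= b < p) carry m y * (y 0 k + b%:R == 0)%:R).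
  apply: eq_bigr => b _; rewrite (carryS k) expgD permM mulnC expgM -/s.
  by rewrite -(sX b y).2; congr (_ * _); apply: depends_carry (sX b y).1.
by rewrite -big_distrr /= sum_digit0 mulr1.
Qed.

(** * The filtration by powers of the odometer *)

Definition coord k : fn := [ffun x : X => x 0 k].

Lemma diff_coord g k : diff g (coord k) = disp g k.
Proof. by apply/ffunP=> x; rewrite !ffunE. Qed.

Local Notation U := (diff odo).

Lemma odo_p_coord m k x : k = m :> nat -> (odo ^+ (p ^ m))%g x 0 k = x 0 k + 1.
Proof. by move=> <-; rewrite odoX (odo_cycle x (ltnW (ltn_ord k))).2. Qed.

(** The function carry k is U applied to the coordinate function of k, which
    U^(p^k) = sigma^(p^k) - 1 sends to the constant 1.  So carry k generates the
    Jordan block of functions of the first k coordinates. *)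
Lemma iter_carry_last k : iter (p ^ k).-1 U (carry k) = [ffun=> 1].
Proof.
rewrite -disp_odo -diff_coord -iterSr prednK ?expn_gt0 ?prime_gt0 //.
rewrite -diff_Frobenius; apply/ffunP=> x.
by rewrite !ffunE odo_p_coord // addrC addKr.
Qed.

Definition V w : {set fn} := [set f | iter w U f == 0].

Lemma V_P w f : reflect (iter w U f = 0) (f \in V w).
Proof. by rewrite inE; apply: eqP. Qed.

Lemma V_iter t w f : (iter t U f \in V w) = (f \in V (w + t)).
Proof. by rewrite !inE iterD. Qed.

Lemma V_diff w f : (U f \in V w) = (f \in V w.+1).
Proof. by rewrite (V_iter 1) addn1. Qed.

Lemma V_sub w w' f : (w <= w')%N -> f \in V w -> f \in V w'.
Proof.
by move=> le_w /V_P Vf; apply/V_P; rewrite -(subnK le_w) iterD Vf iter_diff0.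
Qed.

Lemma V_0 f : f \in V 0 -> f = 0.
Proof. by move/V_P. Qed.

Lemma zeroV w : 0 \in V w.
Proof. by apply/V_P; rewrite iter_diff0. Qed.

Lemma VD w f f' : f \in V w -> f' \in V w -> f + f' \in V w.
Proof. by move=> /V_P Vf /V_P Vf'; apply/V_P; rewrite iter_diffD Vf Vf' addr0. Qed.

Lemma VN w f : f \in V w -> - f \in V w.
Proof. by move=> /V_P Vf; apply/V_P; rewrite iter_diffN Vf oppr0. Qed.

Lemma VB w f f' : f \in V w -> f' \in V w -> f - f' \in V w.
Proof. by move=> Vf Vf'; apply/VD/VN. Qed.

Lemma odo_p_agree m x : (m <= n)%N -> agree m ((odo ^+ (p ^ m))%g x) x.
Proof. by move=> le_m; apply: (odo_cycle x le_m).1. Qed.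

(** A function f in V (p^m) is invariant under sigma^(p^m), hence also under
    sigma^(p^(m+1)); by descending induction f depends on the first m + 1
    coordinates only.  As sigma^(p^m) translates the coordinate m and fixes those
    before it, f does not depend on the coordinate m either. *)
Lemma V_depends m f : (m <= n)%N -> reflect (depends m f) (f \in V (p ^ m)).
Proof.
move=> le_m; apply: (iffP idP) => [|Df]; last first.
  apply/V_P; rewrite -diff_Frobenius.
  by apply: diff_fixed Df => x; apply: odo_p_agree.
have [d Ed] : exists d, (d + m)%N = n by exists (n - m)%N; rewrite subnK.
elim: d m le_m Ed f => [|d IHd] m le_m Ed f Vf.
  by move=> x y Axy; congr (f _); apply: agree_all; rewrite -[n in agree n]Ed.
have lt_m : (m < n)%N by rewrite -[n in (_ < n)%N]Ed ltnS leq_addl.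
have Df: depends m.+1 f.
  apply: IHd; rewrite ?addnS //.
  by apply: V_sub Vf; rewrite leq_exp2l ?prime_gt1.
pose k := Ordinal lt_m; pose s := (odo ^+ (p ^ m))%g.
have fs b x : f ((s ^+ b)%g x) = f x.
  elim: b => [|b IHb]; first by rewrite perm1.
  rewrite expgSr permM -IHb; apply/eqP; rewrite -subr_eq0 -diffE.
  by rewrite diff_Frobenius (V_P _ _ Vf) ffunE.
have sE b x : agree m ((s ^+ b)%g x) x /\ (s ^+ b)%g x 0 k = x 0 k + b%:R.
  elim: b => [|b [IHa IHk]]; first by rewrite perm1 addr0.
  rewrite expgSr permM odo_p_coord // IHk -addrA natr1; split=> // i lt_i.
  by rewrite (odo_p_agree _ le_m) // IHa.
move=> x y Axy; rewrite -(fs (y 0 k - x 0 k) x); apply: Df => i.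
have [sa sk] := sE (y 0 k - x 0 k) x.
rewrite ltnS leq_eqVlt => /predU1P[/(@val_inj _ _ _ i k)->|lt_i].
  by rewrite sk [X in _ + X](natr_Zp (y 0 k - x 0 k)) addrC subrK.
by rewrite sa ?Axy.
Qed.

(** On the first m + 1 coordinates sigma^(p^m) is the translation of the last one
    by 1, which is central among triangular permutations. *)
Lemma pull_odo_p_comm g m f : (m < n)%N -> triangular g -> depends m.+1 f ->
  pull g (diff (odo ^+ (p ^ m)) f) = diff (odo ^+ (p ^ m)) (pull g f).
Proof.
move=> lt_m Tg Df; set s := (odo ^+ _)%g.
suff sg (x : X) : f (s (g x)) = f (g (s x)).
  by apply/ffunP=> x; rewrite !ffunE sg.
have At := odo_p_agree _ (ltnW lt_m).
apply: Df => i; rewrite ltnS leq_eqVlt => /predU1P[|lt_i].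
  move/(@val_inj _ _ _ i (Ordinal lt_m)) => ->.
  rewrite [RHS]dispP !odo_p_coord // dispP.
  by rewrite (Tg (Ordinal lt_m) (s x) x (At x)) addrAC.
by rewrite At //; apply/esym/(triangular_agree Tg (At x)).
Qed.

Lemma depends_iter g m t f : triangular g -> depends m f -> depends m (iter t (diff g) f).
Proof. by move=> Tg Df; elim: t => //= t; apply: depends_diff. Qed.

Lemma diff_odo_iter_comm g m q f : (m < n)%N -> triangular g -> depends m.+1 f ->
  iter (q * p ^ m) U (diff g f) = diff g (iter (q * p ^ m) U f).
Proof.
move=> lt_m Tg Df; elim: q => // q IHq; rewrite mulSn !iterD IHq.
set f' := iter _ _ f; have Df': depends m.+1 f' by apply: depends_iter triangular_odo Df.
by rewrite -!diff_Frobenius {2 3}/diff raddfB /= -pull_odo_p_comm.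
Qed.

(** The case l = 0 says that triangular permutations act trivially on the
    quotients V w / V (w - 1); the case p^l w = p^m bounds how far a deep
    permutation moves an arbitrary function of m coordinates.  In the inductive
    step, f depends on m + 1 coordinates and p^l w = q p^m + p^l r with
    0 < p^l r <= p^m; then U^(q p^m) commutes with diff g on f and sends f to
    V (p^l r), inside the functions of m coordinates. *)
Lemma diff_lowers g l m w f :
    triangular g -> (forall x, agree l (g x) x) -> (l <= m <= n)%N ->
    (p ^ l * w <= p ^ m)%N -> f \in V (p ^ l * w) ->
  diff g f \in V (p ^ l * w.-1).
Proof.
move=> Tg Fg /andP[le_lm].
have p_gt0 e : (0 < p ^ e)%N by rewrite expn_gt0 prime_gt0.
elim: m le_lm w f => [|m IHm].
  rewrite leqn0 => /eqP l0 w f _; rewrite {}l0 in Fg *.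
  rewrite mul1n => le_w Vf.
  have Df: depends 0 f by apply/(V_depends _ (leq0n n)); apply: V_sub Vf.
  by rewrite (diff_fixed Fg Df) zeroV.
rewrite leq_eqVlt => /predU1P[l0|le_l] w f lt_m le_w Vf.
  have Df: depends l f by rewrite l0; apply/(V_depends _ lt_m); apply: V_sub Vf.
  by rewrite (diff_fixed Fg Df) zeroV.
case: w le_w Vf => [|w] le_w Vf.
  by rewrite (V_0 (f := f)) ?raddf0 ?zeroV //; rewrite muln0 in Vf.
(* Dividing w, the predecessor of the original exponent, makes the remainder
   r + 1 used below range over 1 .. P, so that lowering it by 1 is harmless. *)
pose P := (p ^ (m - l))%N; have EP: (p ^ m = p ^ l * P)%N by rewrite -expnD subnKC.
pose q := (w %/ P)%N; pose r := (w %% P)%N; have Ew: w = (q * P + r)%N by apply: divn_eq.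
have ltr : (r < P)%N by rewrite ltn_mod p_gt0.
have Df: depends m.+1 f by apply/(V_depends _ lt_m); apply: V_sub Vf.
have Eq e : (p ^ l * (q * P + e) = p ^ l * e + q * p ^ m)%N.
  by rewrite EP mulnDr addnC mulnCA.
rewrite /= Ew Eq -V_iter diff_odo_iter_comm //.
apply: (IHm le_l r.+1 _ (ltnW lt_m)); first by rewrite EP leq_mul2l ltr orbT.
by rewrite V_iter -Eq addnS -Ew.
Qed.

Lemma diff_lowers1 g w f : triangular g -> (w <= p ^ n)%N -> f \in V w ->
  diff g f \in V w.-1.
Proof.
move=> Tg le_w Vf.
by have:= @diff_lowers g 0 n w f Tg; rewrite !mul1n leqnn; apply.
Qed.

Lemma V_pull g w f : triangular g -> (w <= p ^ n)%N -> f \in V w -> pull g f \in V w.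
Proof.
move=> Tg le_w Vf; rewrite pull_diff VD // (V_sub (leq_pred w)) //.
exact: diff_lowers1.
Qed.

(** The function b w below satisfies U^w (b w) = 1 and U (b (w + 1)) = b w.  As
    U^w maps V (w + 1) to the constants with kernel V w, subtracting a multiple
    of b w from f brings it down to V w. *)
Lemma V_diff_onto k w f : (w < p ^ k)%N -> f \in V w ->
  exists2 f', f' \in V w.+1 & U f' = f.
Proof.
pose b w := iter (p ^ k - w.+1) U (carry k).
have b1 v : (v < p ^ k)%N -> iter v U (b v) = [ffun=> 1].
  move=> lt_v; rewrite -iterD -[RHS](iter_carry_last k); congr (iter _ _ _).
  by rewrite -[in RHS](subnK lt_v) addnS addnC.
have bS v : (v.+1 < p ^ k)%N -> U (b v.+1) = b v.
  by move=> lt_v; rewrite /b -iterS -subSn ?subSS.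
elim: w f => [|w IHw] f lt_w Vf.
  by exists 0; rewrite ?zeroV // raddf0 (V_0 Vf).
have: iter w U f \in V (p ^ 0) by rewrite V_iter.
move/(V_depends _ (leq0n n)) => Df.
pose c : nat := iter w U f 0.
have Vf0: f - b w *+ c \in V w.
  apply/V_P; rewrite iter_diffD iter_diffN.
  have ->: iter w U (b w *+ c) = iter w U (b w) *+ c.
    by elim: (c) => [|a IHa]; rewrite ?iter_diff0 // !mulrSr iter_diffD IHa.
  rewrite b1 1?ltnW //; apply/ffunP=> x; rewrite !ffunE ffunMnE ffunE.
  by rewrite [X in _ - X](natr_Zp (iter w U f 0)) (Df x 0) ?subrr.
have [f' Vf' Uf'] := IHw _ (ltnW lt_w) Vf0.
exists (f' + b w.+1 *+ c); last by rewrite raddfD raddfMn /= Uf' bS // subrK.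
apply: VD; first exact: V_sub Vf'.
elim: (c) => [|a IHa]; rewrite ?mulr0n ?zeroV // mulrSr VD //.
apply/V_P; rewrite iterS b1 //; apply/ffunP=> x.
by rewrite !ffunE subrr.
Qed.

(** * The filtration of the group *)

Definition D i : {set {perm X}} :=
  [set g | [forall k, disp g k \in V (p ^ (k : 'I_n) - i)]].

Lemma D_P i g : reflect (forall k, disp g k \in V (p ^ k - i)) (g \in D i).
Proof. by rewrite inE; apply: forallP. Qed.

Lemma ord_exp_leq k i : (p ^ k - i <= p ^ n)%N.
Proof. by rewrite (leq_trans (leq_subr _ _)) // leq_exp2l ?prime_gt1 // ltnW. Qed.

Lemma D_sub i i' : (i <= i')%N -> D i' \subset D i.
Proof.
move=> le_i; apply/subsetP=> g /D_P Dg; apply/D_P => k.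
by apply: V_sub (Dg k); apply: leq_sub2l.
Qed.

Lemma D0_triangular g : (g \in D 0) <-> triangular g.
Proof.
split=> [/D_P Dg k|Tg]; first by apply/(V_depends _ (ltnW (ltn_ord k))); rewrite -(subn0 (p ^ k)%N).
by apply/D_P => k; rewrite subn0; apply/(V_depends _ (ltnW (ltn_ord k))).
Qed.

Lemma D_triangular i g : g \in D i -> triangular g.
Proof. by move=> Dg; apply/D0_triangular; apply: subsetP Dg; apply: D_sub. Qed.

Lemma disp1 k : disp 1%g k = 0.
Proof. by apply/ffunP=> x; rewrite !ffunE perm1 subrr. Qed.

Lemma dispM g h k : disp (g * h)%g k = pull g (disp h k) + disp g k.
Proof. by apply/ffunP=> x; rewrite !ffunE permM addrA subrK. Qed.

Lemma D_group_set i : group_set (D i).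
Proof.
apply/group_setP; split=> [|g h Dg Dh].
  by apply/D_P => k; rewrite disp1 zeroV.
apply/D_P => k; rewrite dispM VD ?(D_P _ _ Dg) //.
by rewrite V_pull ?(D_P _ _ Dh) ?ord_exp_leq //; apply: D_triangular Dg.
Qed.

Canonical D_group i := Group (D_group_set i).

(** Compare the displacements on both sides of g h = h g [g, h]. *)
Lemma pull_disp_commg g h k :
  pull (h * g)%g (disp [~ g, h]%g k) = diff g (disp h k) - diff h (disp g k).
Proof.
have := dispM (h * g) [~ g, h] k; rewrite -commgC (dispM g) (dispM h) => E.
rewrite -[LHS](addrK (pull h (disp g k) + disp h k)) -E /diff opprB opprD.
by rewrite [RHS]addrACA; congr (_ + _); rewrite addrC.
Qed.

Lemma agree_disp0 g l : (forall k, (k < l)%N -> disp g k = 0) ->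
  forall x, agree l (g x) x.
Proof. by move=> g0 x k lt_k; rewrite dispP g0 // ffunE addr0. Qed.

(** Let l be the least integer with i < p^l.  The displacements of g before l
    are in V 0, so g fixes the first l coordinates and lowers V (p^m) to
    V (p^m - p^l). *)
Lemma diff_depth g i m f :
    triangular g -> (forall k, (k < m)%N -> disp g k \in V (p ^ k - i)) ->
    (m <= n)%N -> depends m f ->
  diff g f \in V (p ^ m - i.+1).
Proof.
move=> Tg Dg le_m Df.
have ex_l : exists l, (i < p ^ l)%N by exists i; rewrite ltn_expl ?prime_gt1.
case: (ex_minnP ex_l) => l lt_i min_l.
have Fg: forall x, agree (minn l m) (g x) x.
  apply: agree_disp0 => k; rewrite leq_min => /andP[lt_kl lt_km].
  apply: V_0; have:= Dg k lt_km; suff /eqP-> : (p ^ k - i == 0)%N by [].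
  rewrite subn_eq0 leqNgt; apply/negP=> /min_l.
  by rewrite leqNgt lt_kl.
case: (leqP m l) => [le_ml|lt_lm].
  by rewrite (minn_idPr le_ml) in Fg; rewrite (diff_fixed Fg Df) zeroV.
rewrite (minn_idPl (ltnW lt_lm)) in Fg.
have Ep : (p ^ l * p ^ (m - l) = p ^ m)%N by rewrite -expnD subnKC // ltnW.
apply: (@V_sub (p ^ l * (p ^ (m - l)).-1)).
  by rewrite -subn1 mulnBr muln1 Ep leq_sub2l.
apply: (@diff_lowers _ _ m) => //; rewrite ?Ep //; last exact/V_depends.
by rewrite ltnW.
Qed.

Lemma V_pullE g w f : g \in D 0 -> (w <= p ^ n)%N -> (pull g f \in V w) = (f \in V w).
Proof.
move=> Dg le_w; apply/idP/idP=> Vf; last by rewrite V_pull //; apply/D0_triangular.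
have ->: f = pull g^-1%g (pull g f) by rewrite -pullM mulVg pull1.
by rewrite V_pull //; apply/D0_triangular/groupVr.
Qed.

Lemma commg_D i g h : g \in D i -> h \in D 0 -> [~ g, h]%g \in D i.+1.
Proof.
move=> Dg Dh; have Dg0: g \in D 0 by apply/D0_triangular/(D_triangular Dg).
have [Tg Th] := ((D0_triangular g).1 Dg0, (D0_triangular h).1 Dh).
apply/D_P => k; rewrite -(V_pullE _ (groupM Dh Dg0)) ?ord_exp_leq //.
rewrite pull_disp_commg VB //; last first.
  by rewrite subnS diff_lowers1 ?ord_exp_leq // (D_P _ _ Dg).
apply: diff_depth (ltnW (ltn_ord k)) (Th k) => // j _.
exact: (D_P _ _ Dg).
Qed.

Definition zero_pad k (v : 'rV['F_p]_k) : X :=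
  \row_j oapp (fun i : 'I_k => v 0 i) 0 (insub (j : nat)).

Lemma agree_zero_pad_prefix k x : agree k (zero_pad (Defs.prefix k x)) x.
Proof.
move=> j lt_j; rewrite !mxE insubT /= mxE.
by congr (x 0 _); apply: val_inj.
Qed.

Lemma disp_Delta k (f : {ffun 'rV['F_p]_k -> 'F_p}) j :
  disp (Delta f) j = [ffun x => if j == k then - f (Defs.prefix k x) else 0].
Proof.
apply/ffunP=> x; rewrite !ffunE permE !mxE eqxx /= addrAC subrr sub0r.
by case: (j == k); rewrite ?mulr1 // mulr0 oppr0.
Qed.

Lemma B_sub_D0 k : B p k \subset D 0.
Proof.
apply/subsetP=> _ /imsetP[f _ ->]; apply/D0_triangular => j x y Axy.
rewrite disp_Delta !ffunE; case: eqP => // Ejk; congr (- f _).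
by apply/rowP=> i; rewrite !mxE; apply: Axy; rewrite Ejk /=.
Qed.

(** The sign of the action of f Delta_k is absorbed in the choice of f. *)
Lemma B_disp k f : depends k f -> exists2 s, s \in B p k &
  disp s k = f /\ forall j, j != k -> disp s j = 0.
Proof.
move=> Df; pose f' : {ffun 'rV['F_p]_k -> 'F_p} := [ffun v => - f (zero_pad v)].
exists (Delta f'); first exact: imset_f.
split=> [|j neq_j]; apply/ffunP=> x; rewrite disp_Delta !ffunE ?(negPf neq_j) //.
by rewrite eqxx opprK; apply/Df/agree_zero_pad_prefix.
Qed.

(** Successive approximation: dividing g by elements of H clears its
    displacements one coordinate after the other. *)
Lemma D_generated i (H : {group {perm X}}) :
    H \subset D i ->
    (forall k f, f \in V (p ^ k - i) -> exists2 u, u \in H &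
       disp u k = f /\ forall j, (j < k)%N -> disp u j = 0) ->
  D i \subset H.
Proof.
move=> sHD genH; apply/subsetP=> g Dg.
suff key d m : (d + m)%N = n -> forall h, h \in D i ->
    (forall j, (j < m)%N -> disp h j = 0) -> h \in H.
  by apply: (key n 0%N) => //; rewrite addn0.
elim: d m => [|d IHd] m Em {Dg}g Dg g0.
  suff ->: g = 1%g by [].
  apply/permP=> x; rewrite perm1; apply: agree_all.
  by rewrite -[n in agree n]Em; apply: agree_disp0.
have lt_m : (m < n)%N by rewrite -[n in (_ < n)%N]Em ltnS leq_addl.
pose k := Ordinal lt_m.
have [u Hu [uk u0]] := genH k (disp g k) (D_P _ _ Dg k).
rewrite -[g](mulKVg u) groupM //; apply: (IHd m.+1); rewrite ?addnS //.
  by rewrite (@groupM _ (D_group i)) ?groupV // (subsetP sHD).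
have uV j : disp u^-1%g j = - pull u^-1%g (disp u j).
  by apply/eqP; rewrite -addr_eq0 addrC -dispM mulVg disp1.
move=> j; rewrite ltnS leq_eqVlt => /predU1P[/(@val_inj _ _ _ j k)->|lt_j].
  by rewrite dispM uV uk subrr.
by rewrite dispM uV u0 // g0 // !raddf0 addr0.
Qed.

Lemma W_eq_D0 : W p n = D 0 :> {set _}.
Proof.
have sWD: W p n \subset D 0.
  by rewrite gen_subG; apply/bigcupsP=> k _; apply: B_sub_D0.
apply/eqP; rewrite eqEsubset sWD D_generated // => k f; rewrite subn0.
move/(V_depends _ (ltnW (ltn_ord k)))/B_disp=> [u Bu [uk u0]].
exists u; first by rewrite mem_gen //; apply/bigcupP; exists k.
by split=> // j lt_j; rewrite u0 // neq_ltn lt_j.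
Qed.

(** To reach a given leading displacement f in V (p^k - i - 1), choose f' with
    U f' = f and take the commutator of sigma^-1 with the element of B_k that
    translates the coordinate k by f'.  The odometer also moves the coordinates
    after k, so this commutator has uncontrolled later displacements; this is
    why D_generated only prescribes the leading one. *)
Lemma lcn_W i : 'L_i.+1(W p n)%g = D i.
Proof.
elim: i => [|i IHi]; first by rewrite lcn1 W_eq_D0.
have sLD : 'L_i.+2(W p n)%g \subset D i.+1.
  rewrite lcnSn IHi gen_subG; apply/subsetP=> _ /imset2P[g h Dg Wh ->].
  by apply: commg_D => //; rewrite -W_eq_D0.
apply/eqP; rewrite eqEsubset sLD; apply: D_generated => // k f Vf.
case: (leqP (p ^ k) i) => [le_i|lt_i].
  exists 1%g; first exact: group1.
  move: Vf; rewrite (eqP (_ : p ^ k - i.+1 == 0)%N) ?subn_eq0 1?ltnW // => /V_0->.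
  by split=> *; rewrite disp1.
have Eki : ((p ^ k - i.+1).+1 = p ^ k - i)%N by rewrite subnSK.
have [|f' Vf' Uf'] := @V_diff_onto k _ f _ Vf.
  by rewrite Eki leq_subr.
rewrite Eki in Vf'.
have Df' : depends k f'.
  by apply/(V_depends _ (ltnW (ltn_ord k))); apply: V_sub Vf'; apply: leq_subr.
have [s _ [sk s0]] := B_disp Df'.
have Ds : s \in D i by apply/D_P=> j; case: (eqVneq j k) => [->|/s0->]; rewrite ?sk ?zeroV.
have Dodo: odo \in D 0 by apply/D0_triangular/triangular_odo.
have Fs : forall x, agree k (s x) x.
  by apply: agree_disp0 => j lt_j; rewrite s0 // neq_ltn lt_j.
have disp_u j : (j <= k)%N ->
    pull (odo^-1 * s)%g (disp [~ s, odo^-1]%g j) = - diff odo^-1%g (disp s j).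
  move=> le_j; rewrite pull_disp_commg (diff_fixed Fs) ?sub0r //.
  by apply: depends_sub le_j _; apply: (D0_triangular _).1; apply/groupVr.
exists [~ s, odo^-1]%g.
  by rewrite /= lcnSn mem_commg ?IHi // W_eq_D0 groupV.
split=> [|j lt_j]; apply: (@pull_inj (odo^-1 * s)%g).
  rewrite disp_u // sk -Uf' pullM (_ : pull s _ = U f').
    by rewrite /diff (raddfB (pull odo^-1)) /= -pullM mulVg pull1 opprB.
  apply/eqP; rewrite -subr_eq0; apply/eqP; apply: (diff_fixed Fs).
  by apply: depends_diff Df'; apply: triangular_odo.
by rewrite disp_u 1?ltnW // s0 ?neq_ltn ?lt_j // !raddf0.
Qed.

Lemma diff_expg g b w f : g \in D 0 -> (w <= p ^ n)%N ->
  diff g f \in V w -> diff (g ^+ b)%g f \in V w.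
Proof.
move=> Dg le_w Vf; elim: b => [|b IHb]; first by rewrite /diff pull1 subrr zeroV.
rewrite /diff expgSr pullM (pull_diff g) raddfD /= addrAC VD //.
by rewrite V_pullE // groupX.
Qed.

(** The displacements of g are treated in increasing order of k, as the bound
    on U (disp g k) uses those before k. *)
Lemma central_mod_D g i : g \in D 0 -> (i < p ^ n.-1)%N ->
  (forall h, h \in D 0 -> [~ g, h]%g \in D i.+1) -> g \in D i.
Proof.
move=> Dg lt_i cg; have Tg := (D0_triangular g).1 Dg.
have cdisp h k : h \in D 0 ->
    diff g (disp h k) - diff h (disp g k) \in V (p ^ k - i.+1).
  move=> Dh; rewrite -pull_disp_commg V_pullE ?groupM ?ord_exp_leq //.
  exact: (D_P _ _ (cg h Dh)).
apply/D_P => k; have [m] := ubnP k; elim: m k => // m IHm k.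
rewrite ltnS => le_km.
have IHk j : (j < k)%N -> disp g j \in V (p ^ j - i).
  by move=> lt_j; apply: IHm; apply: leq_trans le_km.
have Vd : U (disp g k) \in V (p ^ k - i.+1).
  have Dodo : odo \in D 0 by apply/D0_triangular/triangular_odo.
  rewrite -[U _]opprK VN // -[- _](addKr (diff g (disp odo k))) VD ?cdisp ?VN //.
  by apply: diff_depth (ltnW (ltn_ord k)) _; rewrite ?disp_odo //; apply: depends_carry.
case: (ltnP i (p ^ k)) => [lt_ik|le_ki]; first by rewrite V_diff subnSK in Vd.
have Fg : forall x, agree k (g x) x.
  apply: agree_disp0 => j lt_j; apply: V_0; have:= IHk j lt_j.
  suff /eqP-> : (p ^ j - i == 0)%N by [].
  by rewrite subn_eq0 (leq_trans _ le_ki) // leq_exp2l ?prime_gt1 // ltnW.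
(* From here on disp g k is constant, and has to be shown to vanish. *)
have lt_k1 : (k.+1 < n)%N.
  have : (p ^ k < p ^ n.-1)%N by apply: leq_ltn_trans lt_i.
  by rewrite ltn_exp2l ?prime_gt1 // -ltnS (ltn_predK (ltn_ord k)).
pose k1 := Ordinal lt_k1.
have lt_pk : (p ^ k < p ^ k1)%N by rewrite ltn_exp2l ?prime_gt1 /=.
have const_d x : disp g k x = disp g k 0.
  have Dd : disp g k \in V (p ^ 0).
    rewrite expn0 -V_diff; move: Vd.
    by rewrite (eqP (_ : p ^ k - i.+1 == 0)%N) // subn_eq0 leqW.
  by move/(V_depends _ (leq0n n)): Dd; apply.
have [d0|d_neq0] := eqVneq (disp g k 0) 0.
  suff ->: disp g k = 0 by apply: zeroV.
  by apply/ffunP=> x; rewrite const_d d0 ffunE.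
pose b : nat := (disp g k 0)^-1.
have gX a x : agree k ((g ^+ a)%g x) x
    /\ (g ^+ a)%g x 0 k = x 0 k + disp g k 0 * a%:R.
  elim: a => [|a [IHa IHc]]; first by rewrite perm1 mulr0 addr0.
  rewrite expgSr permM; split=> [j lt_j|]; first by rewrite Fg ?IHa.
  by rewrite dispP const_d IHc -addrA -natr1 mulrDr mulr1.
have Dc : depends k1 (carry k1) by apply: depends_carry.
(* The permutation s moves only the coordinate k1, by carry k1, which is in
   V (p^k1) but not in V (p^k1 - 1); commuting g with s bounds diff g of it. *)
have [s Bs [sk s0]] := B_disp Dc.
have Ds : s \in D 0 by apply: subsetP Bs; apply: B_sub_D0.
have Vc : diff g (carry k1) \in V (p ^ k1 - (p ^ k).+1).
  have := cdisp s k1 Ds; rewrite sk (diff_fixed (m := k1) _ (Tg k1)) ?subr0.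
    by apply: V_sub; apply: leq_sub2l.
  by apply: agree_disp0 => j lt_j; rewrite s0 // neq_ltn lt_j.
have: diff (g ^+ b)%g (carry k1) \in V (p ^ k1 - (p ^ k).+1).
  by apply: diff_expg => //; apply: ord_exp_leq.
(* The exponent b is chosen so that g^b adds 1 to the coordinate k. *)
have ->: diff (g ^+ b)%g (carry k1) = iter (p ^ k) U (carry k1).
  rewrite -diff_Frobenius; apply/ffunP=> x; rewrite !diffE; congr (_ - _).
  apply: Dc => j; rewrite ltnS leq_eqVlt => /predU1P[/val_inj->|lt_j].
    by rewrite (gX b x).2 odo_p_coord // [X in _ * X](natr_Zp (_^-1)) mulfV.
  by rewrite (gX b x).1 // odo_p_agree // ltnW.
have E : (p ^ k1 - (p ^ k).+1 + p ^ k)%N = (p ^ k1).-1.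
  by rewrite -[in RHS](subnK lt_pk) addnS.
rewrite V_iter E.
move/V_P; rewrite iter_carry_last => /ffunP/(_ 0); rewrite !ffunE.
by move/eqP; rewrite oner_eq0.
Qed.

(** * Comparison of the two series *)

Lemma D_last : D (p ^ n.-1) = 1%g.
Proof.
apply/trivgP/subsetP=> g /D_P Dg; rewrite inE; apply/eqP/permP=> x.
rewrite perm1; apply: agree_all; apply: agree_disp0 => k _; apply: V_0.
have := Dg k; suff /eqP-> : (p ^ k - p ^ n.-1 == 0)%N by [].
by rewrite subn_eq0 leq_exp2l ?prime_gt1 // -ltnS (ltn_predK (ltn_ord k)).
Qed.

Lemma nilpotent_W : nilpotent (W p n).
Proof. by apply/lcnP; exists (p ^ n.-1)%N; rewrite lcn_W D_last. Qed.

Lemma nil_class_W_leq : (nil_class (W p n) <= p ^ n.-1)%N.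
Proof. by apply/(lcn_nil_classP _ nilpotent_W); rewrite lcn_W D_last. Qed.

Lemma ucn_W i : (i <= nil_class (W p n))%N ->
  'Z_i(W p n)%g = D (nil_class (W p n) - i).
Proof.
set c := nil_class _; elim: i => [|i IHi] lt_i.
  by rewrite ucn0 subn0 -lcn_W; apply/esym/(lcn_nil_classP _ nilpotent_W).
rewrite ucnSnR IHi 1?ltnW // W_eq_D0 -(subnSK lt_i).
apply/setP=> g; rewrite inE; apply/andP/idP=> [[Dg cg]|Dg].
  apply: central_mod_D => // [|h Dh].
    apply: leq_trans nil_class_W_leq.
    by rewrite ltn_subrL /= (leq_ltn_trans _ lt_i).
  by apply: (subsetP cg); rewrite mem_commg ?set11.
split; first by apply: subsetP Dg; apply: D_sub.
rewrite gen_subG; apply/subsetP=> _ /imset2P[g' h /set1P-> Dh ->].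
exact: commg_D.
Qed.

End CentralSeries.

Theorem theorem3p7 (p n : nat) (p_prime : prime p) (p_odd : odd p)
    (n_ge1 : (1 <= n)%N) (i : nat) (i_le_c : (i <= nil_class (W p n))%N) :
  ('Z_i(W p n) = 'L_(nil_class (W p n) + 1 - i)(W p n))%g.
Proof. by rewrite ucn_W // addn1 subSn // lcn_W. Qed.
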